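(* Let $(W,S)$ be a Coxeter system and let $p$ be a core $(I,J)$-coset for finitary $I,J\subset S$. Then all atomic reduced expressions of $p$ have the same width.
   Context: For $I\subset S$, $W_I$ is the subgroup generated by $I$; $I$ is finitary if $W_I$ is finite, and then $w_I$ is the longest element of $W_I$. Write $Is=I\sqcup\{s\}$. For finitary $I,J$, an $(I,J)$-coset is an element $p\in W_I\backslash W/W_J$ (the pair $(I,J)$ is part of the data). It has a unique Bruhat-maximal element $\overline p$ and a unique Bruhat-minimal element $\underline p$. It is core if $I=\underline pJ\underline p^{-1}$. Let $*$ be the Coxeter monoid product on $W$ ($w*s=ws$ if $\ell(ws)>\ell(w)$, else $w*s=w$). For an $(I,J)$-coset $p$ and a $(J,K)$-coset $q$ set $p*q=W_I(\overline p*\overline q)W_K$; it is reduced if $\ell(\overline pw_J^{-1}\overline q)=\ell(\overline pw_J^{-1})+\ell(\overline q)$. An expression is a sequence $[I_0,\dots,I_m]$ of finitary subsets in which consecutive subsets differ by adding or removing one element, also written $[I_0\pm s_1\pm\cdots\pm s_m]$; its width is $m$. It expresses the $(I_0,I_m)$-coset $(W_{I_0}eW_{I_1})*\cdots*(W_{I_{m-1}}eW_{I_m})$, and is reduced if for each $1\le i\le m-1$ the composition of the coset expressed by $[I_0,\dots,I_i]$ with $W_{I_i}eW_{I_{i+1}}$ is reduced. An atom is a core coset having a reduced expression of the form $[I+s-t]$ (equivalently, a coset expressed by $[I+s-t]$ with $Is$ finitary, $s\notin I$, $t=w_{Is}sw_{Is}$). An atomic expression is an expression $[L_0+s_1-t_1+\cdots+s_m-t_m]=[L_0,P_0,L_1,\dots,P_{m-1},L_m]$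 such that each $[L_i,P_i,L_{i+1}]$ expresses an atom. An atomic reduced expression is an atomic expression that is reduced. *)

(* Defs.v *)
From Stdlib Require Import Relation_Operators.
From HB Require Import structures.
From mathcomp Require Import all_boot.
From mathcomp Require Import all_classical.

Set Implicit Arguments.
Unset Strict Implicit.
Unset Printing Implicit Defensive.

Local Open Scope classical_set_scope.
Local Open Scope group_scope.

Definition subgroup_set (W : groupType) (H : set W) : Prop :=
  [/\ H 1, (forall x y, H x -> H y -> H (x * y)) & (forall x, H x -> H x^-1)].

Definition generated (W : groupType) (I : set W) : set W :=
  smallest (@subgroup_set W) I.

(* Bourbaki's definition: S consists of elements of order 2, generates W, and
   W is presented by S with the relations (st)^m(s,t) = 1 for s, t in S with
   m(s,t) = ord(st) finite.  The last clause is the universal property of this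
   presentation; as (st)^n = 1 iff m(s,t) divides n, the relations may be
   written without naming m(s,t). *)
Definition coxeter_system (W : groupType) (S : set W) : Prop :=
  [/\ (forall s, S s -> s != 1 /\ s * s = 1),
      generated S = setT &
      forall (G : groupType) (f : W -> G),
        (forall s t n, S s -> S t -> (s * t) ^+ n = 1 -> (f s * f t) ^+ n = 1) ->
        exists g : W -> G,
          {morph g : x y / x * y} /\ (forall s, S s -> g s = f s)].

Definition word_for (W : groupType) (S : set W) (w : W) (r : seq W) : Prop :=
  (forall s, s \in r -> S s) /\ \prod_(s <- r) s = w.

Definition ell (W : groupType) (S : set W) (w : W) : nat :=
  xget 0%N [set n | (exists2 r, word_for S w r & size r = n) /\
                    (forall r, word_for S w r -> (n <= size r)%N)].

Definition reduced_word (W : groupType) (S : set W) (w : W) (r : seq W) : Prop :=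
  word_for S w r /\ size r = ell S w.

Definition reflection (W : groupType) (S : set W) : set W :=
  [set x * s * x^-1 | x in setT & s in S].

Definition bruhat (W : groupType) (S : set W) : W -> W -> Prop :=
  clos_refl_trans W (fun u v =>
    (exists2 t, reflection S t & v = u * t) /\ (ell S u < ell S v)%N).

(* Independent of the reduced word chosen for v. *)
Definition cox_star (W : groupType) (S : set W) (w v : W) : W :=
  foldl (fun x s => if (ell S x < ell S (x * s))%N then x * s else x)
        w (xget [::] (reduced_word S v)).

Definition finitary (W : groupType) (S I : set W) : Prop :=
  I `<=` S /\ finite_set (generated I).

Definition longest (W : groupType) (S I : set W) : W :=
  xget 1 [set w | generated I w /\
                  (forall v, generated I v -> (ell S v <= ell S w)%N)].

Definition dcoset (W : groupType) (I : set W) (w : W) (J : set W) : set W :=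
  [set x * w * y | x in generated I & y in generated J].

Definition is_coset (W : groupType) (I J p : set W) : Prop :=
  exists w, p = dcoset I w J.

(* For I, J finitary, an (I,J)-coset has exactly one Bruhat-maximal and exactly
   one Bruhat-minimal element. *)
Definition max_elt (W : groupType) (S p : set W) : W :=
  xget 1 [set w | p w /\ (forall v, p v -> bruhat S w v -> v = w)].

Definition min_elt (W : groupType) (S p : set W) : W :=
  xget 1 [set w | p w /\ (forall v, p v -> bruhat S v w -> v = w)].

Definition is_core (W : groupType) (S I J p : set W) : Prop :=
  is_coset I J p /\ I = [set min_elt S p * j * (min_elt S p)^-1 | j in J].

Definition coset_star (W : groupType) (S I K p q : set W) : set W :=
  dcoset I (cox_star S (max_elt S p) (max_elt S q)) K.

Definition star_reduced (W : groupType) (S J p q : set W) : Prop :=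
  ell S (max_elt S p * (longest S J)^-1 * max_elt S q) =
  (ell S (max_elt S p * (longest S J)^-1) + ell S (max_elt S q))%N.

Definition step (W : groupType) (I J : set W) : Prop :=
  exists s, (~ I s /\ J = s |` I) \/ (~ J s /\ I = s |` J).

Definition width (W : groupType) (e : seq (set W)) : nat := (size e).-1.

Definition is_expression (W : groupType) (S : set W) (e : seq (set W)) : Prop :=
  [/\ (0 < size e)%N,
      (forall i, (i <= width e)%N -> finitary S (nth set0 e i)) &
      (forall i, (i < width e)%N -> step (nth set0 e i) (nth set0 e i.+1))].

(* [compose_steps I p K r] composes the (I,K)-coset p on the right with the
   one-step cosets along [K :: r]. *)
Fixpoint compose_steps (W : groupType) (S I p K : set W) (r : seq (set W)) :
    set W :=
  if r is L :: r' then
    compose_steps S I (coset_star S I L p (dcoset K 1 L)) L r'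
  else p.

(* The empty composition, for an expression [I] of width 0, is the identity
   (I,I)-coset. *)
Definition expressed (W : groupType) (S : set W) (e : seq (set W)) : set W :=
  match e with
  | [::] => set0
  | [:: A] => dcoset A 1 A
  | A :: B :: r => compose_steps S A (dcoset A 1 B) B r
  end.

Definition expresses (W : groupType) (S : set W) (e : seq (set W))
    (I J p : set W) : Prop :=
  [/\ is_expression S e, nth set0 e 0 = I, nth set0 e (width e) = J &
      expressed S e = p].

Definition expr_reduced (W : groupType) (S : set W) (e : seq (set W)) : Prop :=
  forall i, (1 <= i < width e)%N ->
    star_reduced S (nth set0 e i) (expressed S (take i.+1 e))
                 (dcoset (nth set0 e i) 1 (nth set0 e i.+1)).

(* [I, P, J] has the form [I + s - t]; s = t is allowed. *)
Definition plus_minus (W : groupType) (I P J : set W) : Prop :=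
  exists s t, [/\ ~ I s, P = s |` I, P t & J = P `\ t].

Definition is_atom (W : groupType) (S I J p : set W) : Prop :=
  is_core S I J p /\
  exists P, [/\ plus_minus I P J, expresses S [:: I; P; J] I J p &
                expr_reduced S [:: I; P; J]].

Definition is_atomic (W : groupType) (S : set W) (e : seq (set W)) : Prop :=
  [/\ is_expression S e, ~~ odd (width e) &
      forall i, (i.*2.+2 <= width e)%N ->
        let L := nth set0 e i.*2 in
        let P := nth set0 e i.*2.+1 in
        let L' := nth set0 e i.*2.+2 in
        plus_minus L P L' /\ is_atom S L L' (expressed S [:: L; P; L'])].

(* Main.v *)
(* Write [p] for the minimal element of the core coset.  An atomic reduced
   expression factors it as a reduced product [a_1 ... a_m] of elements
   [a_i = w_(P_(i-1)) w_(L_i)], each conjugating [W_(L_i)] to [W_(L_(i-1))].  So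
   its left inversion set is the disjoint union of the sets of reflections lying
   in [Q_i] but not in [W_I], where [Q_i] is [W_(P_(i-1))] conjugated by
   [a_1 ... a_(i-1)].  All [Q_i] are parabolic subgroups containing [W_I] as a
   parabolic subgroup of corank one, so [Q_i] is determined by any element of it
   outside [W_I].  Hence the set of the [Q_i] depends only on the inversion set,
   and its cardinality is [m], half the width of the expression. *)
From Stdlib Require Import Relation_Operators.
Require Import Defs.
From HB Require Import structures.
From mathcomp Require Import all_boot.
From mathcomp Require Import all_classical.

Set Implicit Arguments.
Unset Strict Implicit.
Unset Printing Implicit Defensive.

Local Open Scope classical_set_scope.
Local Open Scope group_scope.

(** Lengths are handled through inversions: [inversion w t] says that the reflection [t] shortens
    [w] from the right, and on reflections this is a cocycle in [w] with values modulo 2. Reduced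
    products thus give disjoint unions of inversion sets; left inversions are those of the inverse.
    Cosets, however, are multiplied through Bruhat-maximal elements chosen by [xget]. The bridge is
    that such an element has all left descents in [I] and all right descents in [J], and only one
    element of a double coset has them. Maximal elements can therefore be computed along an
    expression: a reduced step up from [K] to [L] turns [m] into [m w_K^-1 w_L], and a step down
    keeps [m]. After the atoms [a_1, ..., a_i] the maximal element is [a_1 ... a_i w_(L_i)], so [p]
    alone determines [a_1 ... a_m]. That two blocks sharing an element outside [W_I] coincide rests
    on Kilmoyer's theorem and on a count of simple generators, possible because the sets involved
    are finite. *)

Lemma finite_set_argmax (T : eqType) (A : set T) (f : T -> nat) x :
  finite_set A -> A x -> exists2 m, A m & forall y, A y -> (f y <= f m)%N.
Proof.
case/finite_seqP=> r rE Ax; pose P n := `[< exists2 y, A y & f y = n >].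
have exP : exists n, P n by exists (f x); apply/asboolP; exists x.
have Pmax n : P n -> (n <= \max_(y <- r) f y)%N.
  by case/asboolP=> y; rewrite rE => yr <-; apply: leq_bigmax_seq.
case: (ex_maxnP exP Pmax) => _ /asboolP [m Am <-] mmax; exists m => // y Ay.
by apply: mmax; apply/asboolP; exists y.
Qed.

Lemma set_argmin (T : Type) (A : set T) (f : T -> nat) x :
  A x -> exists2 m, A m & forall y, A y -> (f m <= f y)%N.
Proof.
move=> Ax; pose P n := `[< exists2 y, A y & f y = n >].
have exP : exists n, P n by exists (f x); apply/asboolP; exists x.
case: (ex_minnP exP) => _ /asboolP [m Am <-] mmin; exists m => // y Ay.
by apply: mmin; apply/asboolP; exists y.
Qed.

(** * Generated subgroups and words *)

Section Generated.
Variable W : groupType.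
Implicit Types (I : set W) (x y w : W).

Lemma generated_subgroup I : subgroup_set (generated I).
Proof.
split=> [A [[A1 _ _] _]|x y hx hy A hA|x hx A hA] //.
  by case: (hA) => -[_ AM _] _; apply: AM; [exact: hx | exact: hy].
by case: (hA) => -[_ _ AV] _; apply: AV; exact: hx.
Qed.

Lemma generated1 I : generated I 1.
Proof. by case: (generated_subgroup I). Qed.

Lemma generatedM I x y : generated I x -> generated I y -> generated I (x * y).
Proof. by case: (generated_subgroup I) => _ + _; apply. Qed.

Lemma generatedV I x : generated I x -> generated I x^-1.
Proof. by case: (generated_subgroup I) => _ _; apply. Qed.

Lemma generatedVE I x : generated I x^-1 <-> generated I x.
Proof. by split=> /generatedV; rewrite ?invgK. Qed.

Lemma generated_mulr I x y :
  generated I y -> generated I (x * y) <-> generated I x.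
Proof.
move=> hy; split=> [hxy|hx]; last exact: generatedM.
by rewrite -(mulgK y x); apply: generatedM => //; apply: generatedV.
Qed.

Lemma generated_mull I x y :
  generated I x -> generated I (x * y) <-> generated I y.
Proof.
move=> hx; split=> [hxy|hy]; last exact: generatedM.
by rewrite -(mulKg x y); apply: generatedM => //; apply: generatedV.
Qed.

Lemma generatedJ I x y : generated I y -> generated I (x ^ y) <-> generated I x.
Proof.
move=> hy; rewrite conjgE generated_mull ?generated_mulr //.
exact: generatedV.
Qed.

Lemma sub_generated I : I `<=` generated I.
Proof. by move=> x Ix A [_]; apply. Qed.

Lemma generated_min I (A : set W) :
  subgroup_set A -> I `<=` A -> generated I `<=` A.
Proof. by move=> hA IA x; apply; split. Qed.

Lemma generatedS I (I' : set W) : I `<=` I' -> generated I `<=` generated I'.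
Proof.
move=> sI; apply: generated_min; first exact: generated_subgroup.
by apply: (subset_trans sI); exact: sub_generated.
Qed.

Lemma conj_subgroup (A : set W) y :
  subgroup_set A -> subgroup_set [set x | A (x ^ y)].
Proof.
case=> A1 AM AV; split=> [|u v /= hu hv|u /= hu]; rewrite /= ?conj1g //.
  by rewrite conjMg; apply: AM.
by rewrite conjVg; apply: AV.
Qed.

Lemma generated_conj_sub I (I' : set W) y :
  (forall s, I s -> generated I' (s ^ y)) ->
  forall x, generated I x -> generated I' (x ^ y).
Proof.
by move=> h; apply: generated_min => //; apply/conj_subgroup/generated_subgroup.
Qed.

Lemma generated_conj I (I' : set W) y :
  (forall s, I s <-> I' (s ^ y)) ->
  forall x, generated I x <-> generated I' (x ^ y).
Proof.
move=> h x; split.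
  by apply: generated_conj_sub => s /h; apply: sub_generated.
rewrite -{2}[x](conjgK y); apply: generated_conj_sub => s hs.
by apply: sub_generated; rewrite h conjgKV.
Qed.

Lemma prod_rev (r : seq W) : (forall s, s \in r -> s * s = 1) ->
  \prod_(s <- rev r) s = (\prod_(s <- r) s)^-1.
Proof.
elim: r => [|a r IH] hr; first by rewrite big_nil invg1.
rewrite rev_cons -cats1 big_cat big_seq1 /= big_cons invgM IH.
  by congr (_ * _); apply/esym/mulg1_eq/hr; rewrite in_cons eqxx.
by move=> s sr; apply: hr; rewrite in_cons sr orbT.
Qed.

Lemma generated_word I w : (forall s, I s -> s * s = 1) ->
  generated I w -> exists r, word_for I w r.
Proof.
move=> hI; move: w; apply: generated_min; last first.
  move=> s Is; exists [:: s]; split; last by rewrite big_seq1.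
  by move=> t; rewrite mem_seq1 => /eqP->.
split=> [|x y [r [hr <-]] [q [hq <-]]|x [r [hr <-]]].
- by exists [::]; split => //; rewrite big_nil.
- exists (r ++ q); split; last by rewrite big_cat.
  by move=> s; rewrite mem_cat => /orP[/hr|/hq].
- exists (rev r); split; last by rewrite prod_rev // => s /hr/hI.
  by move=> s; rewrite mem_rev; apply: hr.
Qed.

Lemma word_generated I w r : word_for I w r -> generated I w.
Proof.
case=> + <-; elim: r => [|a r IH] hr; rewrite ?big_nil ?big_cons.
  exact: generated1.
apply: generatedM; first by apply: sub_generated; apply: hr;
  rewrite in_cons eqxx.
by apply: IH => s sr; apply: hr; rewrite in_cons sr orbT.
Qed.

End Generated.

(** * The inversion cocycle *)

(* The semidirect product of [W] with the functions [W -> bool] under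
   conjugation.  A homomorphism from [W] to it that is the identity on the first
   component is the same as a cocycle, which is how the universal property of
   the presentation yields the inversion sets. *)
Definition twist (W : groupType) : Type := (W * (W -> bool))%type.

Section Twist.
Variable W : groupType.
Implicit Types a b c : twist W.

HB.instance Definition _ := Choice.on (twist W).

Definition twist_one : twist W := (1, fun=> false).
Definition twist_mul a b : twist W :=
  (a.1 * b.1, fun x => a.2 (x ^ b.1^-1) (+) b.2 x).
Definition twist_inv a : twist W := (a.1^-1, fun x => a.2 (x ^ a.1)).

Lemma twist_mulA : associative twist_mul.
Proof.
move=> [a f] [b g] [c h]; rewrite /twist_mul /= mulgA; congr (_, _).
by apply/funext => x; rewrite invgM conjgM addbA.
Qed.

Lemma twist_mul1 : left_id twist_one twist_mul.
Proof. by case=> a f; rewrite /twist_mul /= mul1g. Qed.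

Lemma twist_mulr1 : right_id twist_one twist_mul.
Proof.
case=> a f; rewrite /twist_mul /= mulg1; congr (_, _); apply/funext => x.
by rewrite invg1 conjg1 addbF.
Qed.

Lemma twist_mulV : left_inverse twist_one twist_inv twist_mul.
Proof.
case=> a f; rewrite /twist_mul /= mulVg; congr (_, _); apply/funext => x.
by rewrite conjgKV addbb.
Qed.

Lemma twist_mulrV : right_inverse twist_one twist_inv twist_mul.
Proof.
case=> a f; rewrite /twist_mul /= mulgV; congr (_, _); apply/funext => x.
by rewrite invgK addbb.
Qed.

HB.instance Definition _ := isGroup.Build (twist W)
  twist_mulA twist_mul1 twist_mulr1 twist_mulV twist_mulrV.

End Twist.

Section Cocycle.
Variables (W : groupType) (S : set W).
Hypothesis hS : coxeter_system S.
Implicit Types (s t w v x : W).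

Lemma coxeter_invol s : S s -> s * s = 1.
Proof. by case: hS => h _ _ /h[]. Qed.

Lemma coxeter_neq1 s : S s -> s != 1.
Proof. by case: hS => h _ _ /h[]. Qed.

Lemma coxeterV s : S s -> s^-1 = s.
Proof. by move/coxeter_invol/mulg1_eq. Qed.

Lemma twist_expg (a : twist W) n :
  a ^+ n = (a.1 ^+ n, fun x =>
    \big[addb/false]_(0 <= k < n) a.2 (x ^ (a.1 ^+ k)^-1)) :> twist W.
Proof.
elim: n => [|n IH].
  by apply: (congr1 (pair (1 : W))); apply/funext => x; rewrite big_nil.
rewrite !expgSr IH; congr (_, _); apply/funext => x /=.
rewrite big_nat_recl //= expg0 invg1 conjg1 addbC; congr (_ (+) _).
by apply: eq_bigr => k _; rewrite expgSr invgM conjgM.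
Qed.

Lemma eq_conjgV x y z : (x ^ y^-1 == z) = (x == z ^ y).
Proof. exact: can2_eq (conjgKV y) (conjgK y) _ _. Qed.

Definition simple_twist s : twist W := (s, fun x => x == s).

(** At [x], the second component of the [n]-th power counts modulo 2 the [j < 2n] with
    [x = t * w ^+ j], where [w = s * t]. As [w ^+ n = 1], the indices [j] and [j + n] contribute
    equally and cancel. *)
Lemma simple_twist_relation s t n : S s -> S t -> (s * t) ^+ n = 1 ->
  (simple_twist s * simple_twist t) ^+ n = 1.
Proof.
move=> Ss St; have [sV tV] := (coxeterV Ss, coxeterV St).
set w := s * t => wn; rewrite twist_expg.
apply: (congr2 (@pair W (W -> bool)) wn); apply/funext => x /=; rewrite -/w.
have wt k : (w ^+ k) ^ t = (w ^+ k)^-1.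
  rewrite conjXg -expVgn; congr (_ ^+ _).
  by rewrite conjgE /w !mulgA tV invgM sV tV -[in LHS]mulgA coxeter_invol
    ?mulg1.
have tw k : t ^ (w ^+ k) = t * w ^+ (k + k).
  rewrite conjgE -wt conjgE tV expgnDr !mulgA; congr (_ * _).
  by rewrite -mulgA coxeter_invol ?mulg1.
have E k : ((x ^ (w ^+ k)^-1) ^ t^-1 == s) (+) (x ^ (w ^+ k)^-1 == t) =
    (x == t * w ^+ (k + k)) (+) (x == t * w ^+ (k + k).+1).
  rewrite !eq_conjgV tw addbC; congr (_ (+) (_ == _)).
  rewrite expgSr mulgA -tw -[s ^ t]/(t^-1 * w) tV conjMg; congr (_ * _).
  by rewrite conjgE (commuteX k (commute_refl w)) mulKg.
under eq_bigr => k _ do rewrite E.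
have -> : \big[addb/false]_(0 <= k < n)
    ((x == t * w ^+ (k + k)) (+) (x == t * w ^+ (k + k).+1)) =
    \big[addb/false]_(0 <= j < n + n) (x == t * w ^+ j).
  elim: (n) => [|m IH]; first by rewrite !big_nil.
  by rewrite big_nat_recr //= IH addnS addSn !big_nat_recr //= addbA.
rewrite (@big_cat_nat _ _ _ n) ?leq_addr //= -{2}[n]add0n big_addn addnK.
under [X in _ (+) X]eq_bigr => j _ do rewrite expgnDr wn mulg1.
exact: addbb.
Qed.

Lemma inversion_cocycle : exists eta : W -> W -> bool,
  (forall w v x, eta (w * v) x = eta w (x ^ v^-1) (+) eta v x) /\
  (forall s x, S s -> eta s x = (x == s)).
Proof.
have [g [gM gS]] : exists g : W -> twist W,
    {morph g : x y / x * y} /\ forall s, S s -> g s = simple_twist s.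
  by case: hS => _ _; apply=> s t n; apply: simple_twist_relation.
have g1 : g 1 = 1 by apply: (@mulgI _ (g 1)); rewrite -gM !mulg1.
have gE w : (g w).1 = w.
  have : generated S w by case: hS => _ -> _.
  move: w; apply: generated_min; last by move=> s /gS /= ->.
  split=> [|x y /= hx hy|x /= hx]; first by rewrite /= g1.
    by rewrite gM /= hx hy.
  by apply/esym/mulg1_eq; rewrite -[x in x * _]hx -[_ * _]/((g x * g x^-1).1)
    -gM mulgV g1.
exists (fun w => (g w).2); split=> [w v x|s x /gS->] //.
by rewrite gM /= gE.
Qed.

End Cocycle.

(** * Length and inversions *)

Section Length.
Variables (W : groupType) (S : set W).
Hypothesis hS : coxeter_system S.
Implicit Types (I : set W) (s t w v x : W) (r : seq W).

Local Notation ell := (ell S).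

Lemma coxeter_word w : exists r, word_for S w r.
Proof.
by apply: generated_word; [exact: coxeter_invol | case: hS => _ -> _].
Qed.

Lemma ell_spec w :
  (exists2 r, word_for S w r & size r = ell w) /\
  (forall r, word_for S w r -> (ell w <= size r)%N).
Proof.
apply: (@xgetPex _ 0%N [set n | (exists2 r, word_for S w r & size r = n) /\
                               (forall r, word_for S w r -> (n <= size r)%N)]).
have [r0 hr0] := coxeter_word w.
by have [r hr rmin] := set_argmin size hr0; exists (size r); split=> //;
  exists r.
Qed.

Lemma reduced_word_exists w : exists r, reduced_word S w r.
Proof. by case: (ell_spec w) => -[r hr szr] _; exists r. Qed.

Lemma ell_le w r : word_for S w r -> (ell w <= size r)%N.
Proof. by case: (ell_spec w) => _; apply. Qed.

Lemma word_cat I w v r q :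
  word_for I w r -> word_for I v q -> word_for I (w * v) (r ++ q).
Proof.
move=> [hr <-] [hq <-]; split; last by rewrite big_cat.
by move=> s; rewrite mem_cat => /orP[/hr|/hq].
Qed.

Lemma word_seq1 I s : I s -> word_for I s [:: s].
Proof.
by move=> Is; split=> [u|]; [rewrite mem_seq1 => /eqP-> | rewrite big_seq1].
Qed.

Lemma word_rcons I w s r :
  word_for I w r -> I s -> word_for I (w * s) (rcons r s).
Proof. by rewrite -cats1 => hr Is; apply: word_cat => //; apply: word_seq1. Qed.

Lemma word_rconsP I w r s :
  word_for I w (rcons r s) -> word_for I (w * s^-1) r /\ I s.
Proof.
case=> h <-; split; last by apply: h; rewrite mem_rcons in_cons eqxx.
split; first by move=> u ur; apply: h; rewrite mem_rcons in_cons ur orbT.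
by rewrite -cats1 big_cat big_seq1 /= mulgK.
Qed.

Lemma word_delete I w r1 s r2 : word_for I w (r1 ++ s :: r2) ->
  word_for I (\prod_(u <- r1 ++ r2) u) (r1 ++ r2).
Proof.
case=> h _; split=> // u; rewrite mem_cat => hu; apply: h.
by rewrite mem_cat in_cons; case/orP: hu => ->; rewrite ?orbT.
Qed.

Lemma ell1 : ell 1 = 0%N.
Proof.
apply/eqP; rewrite -leqn0 (@ell_le _ [::]) //.
by split=> //; rewrite big_nil.
Qed.

Lemma ell_eq0 w : ell w = 0%N -> w = 1.
Proof.
by have [[|? ?] [[_ <-] <-]] := reduced_word_exists w; rewrite ?big_nil.
Qed.

Lemma ellM w v : (ell (w * v) <= ell w + ell v)%N.
Proof.
have [r [hr <-]] := reduced_word_exists w.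
have [q [hq <-]] := reduced_word_exists v.
by rewrite -size_cat; apply: ell_le; apply: word_cat.
Qed.

Lemma ellV_le w : (ell w^-1 <= ell w)%N.
Proof.
have [r [[hr <-] <-]] := reduced_word_exists w.
rewrite -size_rev; apply: ell_le; split; first by move=> s; rewrite mem_rev;
  apply: hr.
by rewrite prod_rev // => s /hr; apply: coxeter_invol.
Qed.

Lemma ellV w : ell w^-1 = ell w.
Proof. by apply/eqP; rewrite eqn_leq ellV_le -{1}[w]invgK ellV_le. Qed.

Lemma ell_simple s : S s -> ell s = 1%N.
Proof.
move=> Ss; apply/eqP; rewrite eqn_leq (ell_le (word_seq1 Ss)) lt0n /=.
by apply: contra (coxeter_neq1 hS Ss) => /eqP/ell_eq0->.
Qed.

Lemma ell1_simple w : ell w = 1%N -> S w.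
Proof.
have [[|s [|? ?]] [[hr <-] <-]] // := reduced_word_exists w.
by rewrite big_seq1 => _; apply: hr; rewrite mem_seq1.
Qed.

Lemma ell_subl w v : (ell w <= ell (w * v) + ell v)%N.
Proof. by rewrite -(ellV v) -{1}[w](mulgK v) ellM. Qed.

Lemma reflectionP t : reflection S t <-> exists2 s, S s & exists x, t = s ^ x.
Proof.
split=> [[x _ [s Ss <-]]|[s Ss [x ->]]].
  by exists s => //; exists x^-1; rewrite conjgE invgK mulgA.
by exists x^-1 => //; exists s => //; rewrite invgK conjgE mulgA.
Qed.

Lemma reflection_simple s : S s -> reflection S s.
Proof. by move=> Ss; apply/reflectionP; exists s => //; exists 1;
  rewrite conjg1. Qed.

Lemma reflectionJ t x : reflection S t -> reflection S (t ^ x).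
Proof.
case/reflectionP=> s Ss [y ->]; apply/reflectionP; exists s => //.
by exists (y * x); rewrite conjgM.
Qed.

Lemma reflection_invol t : reflection S t -> t * t = 1.
Proof.
by case/reflectionP=> s Ss [x ->]; rewrite -conjMg (coxeter_invol hS Ss) conj1g.
Qed.

Lemma reflectionV t : reflection S t -> t^-1 = t.
Proof. by move/reflection_invol/mulg1_eq. Qed.

Definition inversion w t := (ell (w * t) < ell w)%N.

(** The cocycle [eta] agrees with [inversion] on reflections. If [eta w t] holds, unfolding it along
    a word finds a letter whose deletion gives [w * t]; on a reduced word this shortens [w]. If it
    fails, it holds for [w * t], because [eta t t] is true, and then [t] shortens [w * t]. *)
Lemma inversion_spec :
  (forall w v t, reflection S t ->
     inversion (w * v) t = inversion w (t ^ v^-1) (+) inversion v t) /\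
  (forall w r t, word_for S w r -> reflection S t -> inversion w t ->
     exists r1 s r2, r = r1 ++ s :: r2 /\ w * t = \prod_(u <- r1 ++ r2) u).
Proof.
have [eta [etaM etaS]] := inversion_cocycle hS.
have eta1 x : eta 1 x = false.
  by have := etaM 1 1 x; rewrite mulg1 invg1 conjg1 addbb.
have exch w r t : word_for S w r -> eta w t ->
    exists r1 s r2, r = r1 ++ s :: r2 /\ w * t = \prod_(u <- r1 ++ r2) u.
  elim/last_ind: r w t => [|r s IH] w t.
    by case=> _ <-; rewrite big_nil eta1.
  case/word_rconsP=> hr Ss; rewrite -{1}[w](mulgVK s) etaM (etaS s) //.
  case: eqVneq => [->{t} _|_]; last rewrite addbF.
    exists r, s, [::]; rewrite cats1 cats0; split=> //.
    by case: hr => _ ->; rewrite (coxeterV hS Ss).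
  case/(IH _ _ hr) => r1 [u [r2 [-> E]]].
  exists r1, u, (rcons r2 s); split; first by rewrite rcons_cat.
  rewrite -rcons_cat -cats1 big_cat big_seq1 /= -E conjgE invgK.
  by rewrite !mulgA !mulgVK.
have etaN w t : eta w t -> inversion w t.
  have [r [hr szr]] := reduced_word_exists w.
  case/(exch _ _ _ hr) => r1 [s [r2 [rE E]]]; rewrite /inversion -szr E rE.
  rewrite rE in hr; apply: leq_ltn_trans (ell_le (word_delete hr)) _.
  by rewrite !size_cat /= addnS.
(* For [t = s ^ x] the contributions of [x^-1] and [x] cancel, since [eta] vanishes at
   [x^-1 * x = 1]; that of [s] remains. *)
have etaR t : reflection S t -> eta t t.
  case/reflectionP=> s Ss [x ->]; rewrite {1}conjgE !etaM (etaS s) // conjgK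
    eqxx.
  have -> : (s ^ x) ^ (s * x)^-1 = s.
    by rewrite -conjgM invgM mulVKg conjgE invgK mulgV mulg1.
  have := etaM x^-1 x (s ^ x); rewrite mulVg eta1 conjgK => /esym.
  by do 2!case: (eta _ _).
have etaE w t : reflection S t -> eta w t = inversion w t.
  move=> ht; apply/idP/idP; first exact: etaN.
  apply: contraTT => Nw; rewrite /inversion -leqNgt ltnW //.
  suff: inversion (w * t) t by rewrite /inversion -mulgA reflection_invol
    ?mulg1.
  by apply: etaN; rewrite etaM conjgE invgK mulgV mulg1 (negPf Nw) etaR.
split=> [w v t ht|w r t hr ht].
- by rewrite -!etaE //; apply: reflectionJ.
- by rewrite -etaE //; apply: exch.
Qed.
Lemma inversionM w v t : reflection S t ->
  inversion (w * v) t = inversion w (t ^ v^-1) (+) inversion v t.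
Proof. by case: inversion_spec => h _; apply: h. Qed.

Lemma exchange w r t : word_for S w r -> reflection S t -> inversion w t ->
  exists r1 s r2, r = r1 ++ s :: r2 /\ w * t = \prod_(u <- r1 ++ r2) u.
Proof. by case: inversion_spec => _; apply. Qed.

Lemma inversion1 t : inversion 1 t = false.
Proof. by rewrite /inversion ell1. Qed.

Lemma inversion_refl t : reflection S t -> inversion t t.
Proof.
move=> ht; rewrite /inversion reflection_invol // ell1 lt0n.
case/reflectionP: (ht) => s Ss [x ->]; apply: contra (coxeter_neq1 hS Ss).
by move/eqP/ell_eq0/eqP; rewrite conjg_eq1.
Qed.

Lemma inversion_mult w t : reflection S t ->
  inversion (w * t) t = ~~ inversion w t.
Proof.
move=> ht; rewrite inversionM // inversion_refl // addbT.
by rewrite conjgE mulgV mulg1 invgK.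
Qed.

Lemma inversionN w t : reflection S t ->
  ~~ inversion w t = (ell w < ell (w * t))%N.
Proof.
move=> ht; rewrite -inversion_mult // /inversion -mulgA.
by rewrite reflection_invol ?mulg1.
Qed.

Lemma ell_inversion w s : S s -> inversion w s -> ell w = (ell (w * s)).+1.
Proof.
move=> Ss Nws; apply/eqP; rewrite eqn_leq; apply/andP; split=> //.
by rewrite -addn1 -(ell_simple Ss) ell_subl.
Qed.

Lemma ell_noninversion w s : S s -> ~~ inversion w s ->
  ell (w * s) = (ell w).+1.
Proof.
move=> Ss; rewrite (inversionN _ (reflection_simple Ss)) => h.
by apply/eqP; rewrite eqn_leq h andbT -addn1 -(ell_simple Ss) ellM.
Qed.

(** A reflection inverted by both factors would shorten both in
    [w * v = (w * t ^ v^-1) * (v * t)]. *)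
Lemma inversion_disjoint w v t : ell (w * v) = (ell w + ell v)%N ->
  reflection S t -> inversion v t -> ~~ inversion w (t ^ v^-1).
Proof.
move=> E ht Nv; apply/negP => Nw; suff : (ell (w * v) < ell w + ell v)%N by
  rewrite E ltnn.
have {1}-> : w * v = (w * t ^ v^-1) * (v * t).
  by rewrite conjgE invgK !mulgA mulgVK -[RHS]mulgA reflection_invol // mulg1.
by apply: leq_ltn_trans (ellM _ _) _; rewrite -addSn leq_add // ltnW.
Qed.

Lemma word_forS I (I' : set W) w r : I `<=` I' -> word_for I w r ->
  word_for I' w r.
Proof. by move=> sI [hr wE]; split=> // s /hr/sI. Qed.

(** * Parabolic subgroups *)

Section Parabolic.
Variable I : set W.
Hypothesis IS : I `<=` S.

(** Exchange only deletes letters, so a word in [I] can be made reduced over [S] without leaving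
    [I]. *)
Lemma generated_reduced w :
  generated I w -> exists2 r, word_for I w r & size r = ell w.
Proof.
have hI s : I s -> s * s = 1 by move/IS; apply: coxeter_invol.
case/(generated_word hI) => r; elim/last_ind: r w => [|r s IH] w.
  by move=> hr; exists [::] => //; case: hr => _ <-; rewrite big_nil ell1.
case/word_rconsP=> /IH [q hq szq] Is; have Ss := IS Is.
rewrite (coxeterV hS Ss) in hq szq.
have wE : w = w * s * s by rewrite -mulgA hI ?mulg1.
have [Nw|Nw] := boolP (inversion (w * s) s); last first.
  exists (rcons q s); first by rewrite {1}wE; apply: word_rcons.
  by rewrite size_rcons szq -(ell_noninversion Ss Nw) -wE.
have [q1 [u [q2 [qE E]]]] := exchange (word_forS IS hq) (reflection_simple Ss)
  Nw.
rewrite -wE in E; exists (q1 ++ q2).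
  by rewrite qE in hq; rewrite E; exact: word_delete hq.
apply/eqP; rewrite -eqSS.
by move: (ell_inversion Ss Nw); rewrite -szq qE !size_cat /= addnS -wE => ->.
Qed.

Lemma inversion_generated w t :
  generated I w -> reflection S t -> inversion w t -> generated I t.
Proof.
move=> gw ht Nw; have [r hr _] := generated_reduced gw.
have [r1 [u [r2 [rE E]]]] := exchange (word_forS IS hr) ht Nw.
rewrite rE in hr; have := word_generated (word_delete hr).
by rewrite -E generated_mull.
Qed.

Lemma simple_generated s : S s -> generated I s -> I s.
Proof.
move=> Ss gs.
have [[|u [|? ?]] hr szr] := generated_reduced gs;
  rewrite ?ell_simple // in szr.
by case: hr => h <-; rewrite big_seq1; apply: h; rewrite mem_seq1.
Qed.
Lemma reduced_word_rcons w r s : reduced_word S w (rcons r s) ->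
  [/\ S s, inversion w s & reduced_word S (w * s) r].
Proof.
case=> /word_rconsP [hr Ss]; rewrite (coxeterV hS Ss) size_rcons in hr * => szr.
have Nw : inversion w s by rewrite /inversion -szr ltnS ell_le.
split=> //; split=> //; apply/eqP; rewrite -eqSS szr.
by apply/eqP; apply: ell_inversion.
Qed.

Lemma reduced_word_generated w r s :
  reduced_word S w r -> generated I w -> s \in r -> I s.
Proof.
elim/last_ind: r w s => [//|r u IH] w s /reduced_word_rcons[Su Nw hr] gw.
have gu := inversion_generated gw (reflection_simple Su) Nw.
rewrite mem_rcons in_cons => /orP[/eqP->|]; first exact: simple_generated.
by apply: IH hr _; rewrite generated_mulr.
Qed.

Lemma descent_exists w : generated I w -> w <> 1 ->
  exists2 s, I s & inversion w s.
Proof.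
move=> gw w1; have [r hr] := reduced_word_exists w.
case/lastP: r hr => [[[_ /esym + _]]|r s hr]; first by rewrite big_nil.
have [_ Nw _] := reduced_word_rcons hr; exists s => //.
by apply: reduced_word_generated hr gw _; rewrite mem_rcons in_cons eqxx.
Qed.

(** Minimality in [w W_I], asked for all reflections of [W_I] so that it can be applied to
    conjugates under [W_I]. Maximality asks only for simple descents, the form easiest to check; for
    finite [W_I] the full form follows in [coset_max_inversion]. *)
Definition coset_min w :=
  forall t, reflection S t -> generated I t -> ~~ inversion w t.

Definition coset_max w := forall s, I s -> inversion w s.

Lemma coset_minM x v : coset_min x -> generated I v ->
  ell (x * v) = (ell x + ell v)%N.
Proof.
move=> xmin gv; have [r] := reduced_word_exists v.
elim/last_ind: r v gv => [|r s IH] v gv hr.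
  by case: hr => -[_ <-] _; rewrite big_nil mulg1 ell1 addn0.
have [Ss Nv {}hr] := reduced_word_rcons hr.
have Is : I s by apply: simple_generated (inversion_generated gv
  (reflection_simple Ss) Nv).
have gs := sub_generated Is.
have E : ell (x * (v * s)) = (ell x + ell (v * s))%N.
  by apply: IH hr; rewrite generated_mulr.
rewrite (ell_inversion Ss Nv) addnS -E mulgA; apply: ell_inversion => //.
rewrite inversionM; last exact: reflection_simple.
rewrite Nv addbT; apply: xmin; last by rewrite generatedJ ?generatedVE.
exact/reflectionJ/reflection_simple.
Qed.

Lemma coset_min_inversion x v t : coset_min x -> generated I v ->
  reflection S t -> generated I t -> inversion (x * v) t = inversion v t.
Proof.
move=> xmin gv ht gt; rewrite inversionM //.
rewrite -[inversion x _]negbK xmin //; first exact: reflectionJ.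
by rewrite generatedJ ?generatedVE.
Qed.

Lemma coset_min_exists w : exists2 v, generated I v & coset_min (w * v).
Proof.
have [v gv vmin] := set_argmin (fun v => ell (w * v)) (@generated1 _ I).
exists v => // t _ gt; rewrite /inversion -leqNgt -mulgA; apply: vmin.
exact: generatedM.
Qed.

Lemma coset_min_unique x c :
  coset_min x -> coset_min (x * c) -> generated I c -> c = 1.
Proof.
move=> xmin xcmin gc; have [//|/eqP c1] := eqVneq c 1.
have [s Is Ns] := descent_exists gc c1.
have [rs gs] := (reflection_simple (IS Is), sub_generated Is).
by have := xcmin s rs gs; rewrite coset_min_inversion // Ns.
Qed.

Section Finite.
Hypothesis Ifin : finite_set (generated I).

Local Notation wI := (longest S I).

Lemma longest_spec :
  generated I wI /\ forall v, generated I v -> (ell v <= ell wI)%N.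
Proof.
apply: (@xgetPex _ 1 [set w | generated I w /\
  (forall v, generated I v -> (ell v <= ell w)%N)]).
have [m gm mmax] := finite_set_argmax ell Ifin (@generated1 _ I).
by exists m.
Qed.

Lemma longest_generated : generated I wI.
Proof. by case: longest_spec. Qed.

Lemma longest_inversion t :
  reflection S t -> generated I t -> inversion wI t.
Proof.
move=> ht gt; apply: contraT; rewrite inversionN // ltnNge.
have [gw wmax] := longest_spec.
by rewrite wmax //; apply: generatedM.
Qed.

Lemma longestV_inversion t :
  reflection S t -> generated I t -> inversion wI^-1 t.
Proof.
move=> ht gt; apply: contraT; rewrite inversionN // ltnNge.
have [gw wmax] := longest_spec.
rewrite ellV wmax //; apply: generatedM => //; exact: generatedV.
Qed.

(** Write [w = x * v^-1] with [x] minimal. A descent of [c = wI^-1 * v^-1] would cancel in the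
    cocycle against [wI], which inverts every reflection of [W_I], and so would not be a descent of
    [w]. Hence [c = 1]. *)
Lemma coset_max_longest w : coset_max w ->
  coset_min (w * wI^-1) /\ ell w = (ell (w * wI^-1) + ell wI)%N.
Proof.
move=> wmax; have [v gv vmin] := coset_min_exists w.
have gw := longest_generated.
set x := w * v in vmin; have wE : w = x * v^-1 by rewrite mulgK.
have gV : generated I v^-1 by rewrite generatedVE.
pose c := wI^-1 * v^-1.
have gc : generated I c by apply: generatedM => //; rewrite generatedVE.
suff c1 : c = 1.
  have vE : v^-1 = wI by rewrite -[LHS](mulVKg wI) -/c c1 mulg1.
  have -> : w * wI^-1 = x by rewrite -vE invgK.
  by split=> //; rewrite -coset_minM // -vE -wE.
have [//|/eqP c1] := eqVneq c 1; have [s Is Ns] := descent_exists gc c1.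
have [rs gs] := (reflection_simple (IS Is), sub_generated Is).
have := wmax s Is; rewrite wE coset_min_inversion // -[v^-1](mulVKg wI) -/c.
rewrite inversionM // Ns longest_inversion //; first exact: reflectionJ.
by rewrite generatedJ ?generatedVE.
Qed.

Lemma coset_max_inversion w t : coset_max w ->
  reflection S t -> generated I t -> inversion w t.
Proof.
move=> /coset_max_longest[wmin _] ht gt; rewrite -[w](mulgVK wI).
rewrite coset_min_inversion //; first exact: longest_inversion.
exact: longest_generated.
Qed.

Lemma coset_max_unique w c :
  coset_max w -> coset_max (w * c) -> generated I c -> c = 1.
Proof.
move=> wmax wcmax gc; have [//|/eqP c1] := eqVneq c 1.
have [s Is Ns] := descent_exists gc c1.
have [rs gs] := (reflection_simple (IS Is), sub_generated Is).
have := wcmax s Is; rewrite inversionM // Ns coset_max_inversion //.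
  exact: reflectionJ.
by rewrite generatedJ ?generatedVE.
Qed.

Lemma longest_coset_max : coset_max wI.
Proof.
by move=> s Is; apply: longest_inversion;
  [exact/reflection_simple/IS | exact: sub_generated].
Qed.

Lemma longestV_coset_max : coset_max wI^-1.
Proof.
by move=> s Is; apply: longestV_inversion;
  [exact/reflection_simple/IS | exact: sub_generated].
Qed.

(** The Coxeter product of [x] with [v] ends in [v], with lengths adding. When a letter [s] is
    skipped, [s] is a descent of [y = c * (v * s)] but not of [v * s]; the conjugate reflection is
    then an inversion of [c], and moving it out of [c] makes room for the longer factor [v]. *)
Lemma foldl_star_reduced x v r : reduced_word S v r ->
  exists c, let y := foldl (fun x s => if (ell x < ell (x * s))%N
                                       then x * s else x) x r in
    y = c * v /\ ell y = (ell c + ell v)%N.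
Proof.
elim/last_ind: r v => [|r s IH] v.
  case=> -[_ <-] _; exists x => /=; rewrite big_nil mulg1.
  by rewrite ell1 addn0.
case/reduced_word_rcons=> Ss Nv /IH [c /= []].
rewrite -cats1 foldl_cat /=; set y := foldl _ _ _ => yE szy.
have rs := reflection_simple Ss; have ss := coxeter_invol hS Ss.
rewrite -inversionN //; case: ifP => Ny.
  exists c; rewrite yE -mulgA -[v * s * s]mulgA ss mulg1; split=> //.
  rewrite (ell_inversion Ss Nv) addnS -szy -(ell_noninversion Ss Ny) yE.
  by rewrite -!mulgA ss mulg1.
have /negbFE {}Ny := Ny.
have Nvs : ~~ inversion (v * s) s by rewrite inversion_mult // negbK.
have E : y = c * s ^ (v * s)^-1 * v.
  by rewrite yE conjgE invgK invgM (coxeterV hS Ss) !mulgA mulgVK -[RHS]mulgA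
    ss mulg1.
exists (c * s ^ (v * s)^-1); split=> //.
have Nc : inversion c (s ^ (v * s)^-1).
  by move: Ny; rewrite yE inversionM // (negPf Nvs) addbF.
apply/eqP; rewrite eqn_leq {1}E ellM szy (ell_inversion Ss Nv) addnS.
by rewrite -addSn leq_add2r.
Qed.

Lemma foldl_star_coset x r : (forall s, s \in r -> I s) ->
  exists2 c, generated I c &
    foldl (fun x s => if (ell x < ell (x * s))%N then x * s else x) x r = x * c.
Proof.
elim: r x => [|s r IH] x hr /=.
  by exists 1; rewrite ?mulg1 //; apply: generated1.
have Is : I s by apply: hr; rewrite in_cons eqxx.
have {}IH y : _ := IH y (fun u ur => hr u (mem_behead (s := s :: r) ur)).
case: ifP => _; last exact: IH.
have [c gc ->] := IH (x * s); exists (s * c); last by rewrite mulgA.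
by apply: generatedM => //; apply: sub_generated.
Qed.

(** The product stays in [x W_I] and ends in [wI] with lengths adding, so it has every descent in
    [I]; only one element of [x W_I] has them all. *)
Lemma cox_star_longest x v : generated I v -> coset_max (x * v) ->
  cox_star S x wI = x * v.
Proof.
move=> gv xvmax; rewrite /cox_star; set r := xget _ _.
have hr : reduced_word S wI r by apply: (@xgetPex _ [::] (reduced_word S wI));
  exact: reduced_word_exists.
have rI s : s \in r -> I s.
  exact: (reduced_word_generated hr longest_generated).
have [c gc E] := foldl_star_coset x rI.
have [d /= [E' szE]] := foldl_star_reduced x hr.
rewrite E in E' szE *; rewrite E' in szE.
have cmax : coset_max (x * v * (v^-1 * c)).
  rewrite mulgA mulgK E' => s Is; rewrite /inversion szE -mulgA.
  apply: leq_ltn_trans (ellM _ _) _; rewrite ltn_add2l.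
  exact: longest_coset_max.
have gvc : generated I (v^-1 * c) by apply: generatedM; rewrite ?generatedVE.
by rewrite -[c](mulVKg v) (coset_max_unique xvmax cmax gvc) mulg1.
Qed.

End Finite.
End Parabolic.

(** * Double cosets *)

Lemma bruhat_ell u v : bruhat S u v -> u = v \/ (ell u < ell v)%N.
Proof.
elim=> {u v} [u v [_ ?]|u|u v w _ [->|h1] _ [<-|h2]]; try by [left|right].
by right; apply: ltn_trans h2.
Qed.

Lemma bruhat_mulr u t : reflection S t -> ~~ inversion u t ->
  bruhat S u (u * t).
Proof.
by move=> ht; rewrite inversionN // => h; apply: rt_step; split=> //; exists t.
Qed.

Lemma inversionV_simple u s : S s -> inversion u^-1 s = inversion u (s ^ u).
Proof.
move=> Ss; rewrite /inversion conjgE mulVKg ellV.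
by rewrite -(ellV (s * u)) invgM (coxeterV hS Ss).
Qed.

Lemma dcoset_refl (I J : set W) w : dcoset I w J w.
Proof.
by exists 1; [exact: generated1|exists 1; rewrite ?mul1g ?mulg1 //;
  exact: generated1].
Qed.

Lemma dcosetP (I J : set W) w v : dcoset I w J v <->
  exists a b, [/\ generated I a, generated J b & v = a * w * b].
Proof.
by split=> [[a ga [b gb <-]]|[a [b [ga gb ->]]]];
  [exists a, b | exists a => //; exists b].
Qed.

Lemma dcosetM (I J : set W) w v a b : generated I a -> generated J b ->
  dcoset I w J v -> dcoset I w J (a * v * b).
Proof.
move=> ga gb /dcosetP[c [d [gc gd ->]]]; apply/dcosetP.
by exists (a * c), (d * b); split; rewrite ?mulgA //; apply: generatedM.
Qed.

Lemma dcoset_sym (I J : set W) w v : dcoset I w J v -> dcoset I v J w.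
Proof.
case/dcosetP=> a [b [ga gb ->]]; apply/dcosetP; exists a^-1, b^-1.
by split; rewrite ?generatedVE // !mulgA mulVg mul1g mulgK.
Qed.

Lemma dcoset_eq (I J : set W) w v : dcoset I w J v ->
  dcoset I w J = dcoset I v J.
Proof.
move=> hv; apply/seteqP; split=> u /dcosetP[a [b [ga gb ->]]];
  apply: dcosetM => //.
exact: dcoset_sym.
Qed.

(* A right descent [s] of [a^-1] is an inversion of [v^-1 = b^-1 m^-1 a^-1] and
   of both [a^-1] and, conjugated, [m^-1]; so conjugated by [a m] it is one of
   [b^-1], hence lies in [W_J], and can be moved from [a] to [b]. *)
Lemma bimax_unique (I J : set W) v m a b : finitary S I -> finitary S J ->
  coset_max J v -> coset_max J m -> coset_max I v^-1 -> coset_max I m^-1 ->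
  generated I a -> generated J b -> v = a * m * b -> v = m.
Proof.
move=> [IS Ifin] [JS Jfin] vJ mJ vI mI.
have [n] := ubnP (ell a); elim: n a b => // n IH a b; rewrite ltnS =>
  szn ga gb vE.
have [a1|a1] := eqVneq a 1.
  rewrite a1 mul1g in vE; rewrite vE in vJ *.
  by rewrite (coset_max_unique JS Jfin mJ vJ gb) mulg1.
have gaV : generated I a^-1 by rewrite generatedVE.
have [|s Is Ns] := descent_exists IS gaV; first by apply/eqP; rewrite invg_eq1.
have [rs gs] := (reflection_simple (IS _ Is), sub_generated Is).
have := vI s Is; rewrite {1}vE !invgM inversionM // inversionM // Ns.
rewrite !invgM !invgK (coset_max_inversion IS Ifin mI); last 2 first.
- exact: reflectionJ.
- by rewrite generatedJ.
rewrite /= addbF => Nb.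
have gt : generated J (s ^ (a * m)).
  by apply: inversion_generated Nb; rewrite ?generatedVE //; apply: reflectionJ.
apply: (IH (s * a) (s ^ (a * m) * b)).
- apply: leq_trans szn; rewrite -(ellV a) -(ellV (s * a)) invgM.
  by rewrite (coxeterV hS (IS _ Is)); apply: Ns.
- exact: generatedM.
- exact: generatedM.
rewrite {1}vE mulgA; congr (_ * _); rewrite -[s * a * m]mulgA -mulgA.
by rewrite conjgE mulVKg mulgA (coxeter_invol hS (IS _ Is)) mul1g.
Qed.

Definition bimax (I J : set W) m := coset_max J m /\ coset_max I m^-1.

(** At a Bruhat-maximal element, a reflection that stays in the coset cannot go up. This yields all
    left and right simple descents, and [bimax_unique] identifies the element. *)
Lemma max_eltE (I J : set W) w m : finitary S I -> finitary S J ->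
  dcoset I w J m -> bimax I J m -> max_elt S (dcoset I w J) = m.
Proof.
move=> fI fJ hm [mJ mI]; have [[IS Ifin] [JS Jfin]] := (fI, fJ).
pose P v := dcoset I w J v /\
  forall u, dcoset I w J u -> bruhat S v u -> u = v.
have exP : exists v, P v.
  have fin : finite_set (dcoset I w J).
    apply: (finite_image2 (fun x y => x * w * y)) Ifin Jfin.
  have [v hv vmax] := finite_set_argmax ell fin hm; exists v; split=> // u hu.
  by case/bruhat_ell=> // vu; have := vmax u hu; rewrite leqNgt vu.
have [Mw Mmax] : P (max_elt S (dcoset I w J)) by apply: xgetPex.
set M := max_elt _ _ in Mw Mmax *.
have asc t : reflection S t -> dcoset I w J (M * t) -> inversion M t.
  move=> ht Mt; apply: contraT => /(bruhat_mulr ht)/(Mmax _ Mt) Mt1.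
  by have := inversion_refl ht; rewrite -[t](mulKg M) Mt1 mulVg inversion1.
have MJ : coset_max J M.
  move=> s Js; apply: asc; first exact/reflection_simple/JS.
  by rewrite -[M]mul1g; apply: dcosetM => //;
    [exact: generated1 | exact: sub_generated].
have MI : coset_max I M^-1.
  move=> s Is; rewrite inversionV_simple; last exact: IS.
  apply: asc; first exact/reflectionJ/reflection_simple/IS.
  rewrite conjgE mulVKg -[_ * _]mulg1; apply: dcosetM => //;
    last exact: generated1.
  exact: sub_generated.
rewrite (dcoset_eq hm) in Mw; case/dcosetP: Mw => a [b [ga gb ME]].
exact: (bimax_unique fI fJ MJ mJ MI mI ga gb ME).
Qed.

Lemma min_elt_spec (I J : set W) w : J `<=` S ->
  dcoset I w J (min_elt S (dcoset I w J)) /\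
  coset_min J (min_elt S (dcoset I w J)).
Proof.
move=> JS; pose P v := dcoset I w J v /\
  forall u, dcoset I w J u -> bruhat S u v -> u = v.
have exP : exists v, P v.
  have [v hv vmin] := set_argmin ell (dcoset_refl I J w).
  exists v; split=> // u hu.
  by case/bruhat_ell=> // vu; have := vmin u hu; rewrite leqNgt vu.
have [Mw Mmin] : P (min_elt S (dcoset I w J)) by apply: xgetPex.
set M := min_elt _ _ in Mw Mmin *; split=> // t ht gt; apply/negP => Nt.
have Mt : dcoset I w J (M * t).
  by rewrite -[M]mul1g; apply: dcosetM => //; exact: generated1.
suff : bruhat S (M * t) M.
  move/(Mmin _ Mt) => Mt1.
  by have := inversion_refl ht; rewrite -[t](mulKg M) Mt1 mulVg inversion1.
by apply: rt_step; split=> //; exists t; rewrite // -mulgA reflection_invol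
  ?mulg1.
Qed.

Lemma bimax_longest (I J : set W) : J `<=` I -> finitary S I ->
  bimax I J (longest S I).
Proof.
move=> JI [IS Ifin]; split=> [s /JI|]; first exact: longest_coset_max.
exact: longestV_coset_max.
Qed.

Lemma bimax_longestr (I J : set W) : I `<=` J -> finitary S J ->
  bimax I J (longest S J).
Proof.
move=> JI [IS Ifin]; split=> [|s /JI]; first exact: longest_coset_max.
exact: longestV_coset_max.
Qed.

Lemma dcoset1_longest (I J : set W) : finitary S I ->
  dcoset I 1 J (longest S I).
Proof.
move=> [IS Ifin]; apply/dcosetP; exists (longest S I), 1; rewrite !mulg1.
by split=> //; [exact: longest_generated | exact: generated1].
Qed.

Lemma dcoset1_longestr (I J : set W) : finitary S J ->
  dcoset I 1 J (longest S J).
Proof.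
move=> [IS Ifin]; apply/dcosetP; exists 1, (longest S J); rewrite !mul1g.
by split=> //; [exact: generated1 | exact: longest_generated].
Qed.

Definition coset_with_max (I K p : set W) m := p = dcoset I m K /\ bimax I K m.

(** * Atoms *)

(** Reducedness says that [y * w_L] has additive length, hence all right descents in [L]; being in
    [m W_L], it is the Coxeter product of [m] with [w_L]. *)
Lemma coset_star_up (I K L p : set W) m :
  finitary S I -> finitary S K -> finitary S L -> K `<=` L ->
  coset_with_max I K p m -> star_reduced S K p (dcoset K 1 L) ->
  let y := m * (longest S K)^-1 in
  coset_with_max I L (coset_star S I L p (dcoset K 1 L)) (y * longest S L) /\
  ell (y * longest S L) = (ell y + ell (longest S L))%N.
Proof.
move=> fI fK fL KL [-> mIK]; have [mK mI] := mIK.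
have [[KS Kfin] [LS Lfin]] := (fK, fL).
rewrite /star_reduced /coset_star (max_eltE fI fK (dcoset_refl _ _ _) mIK).
rewrite (max_eltE fK fL (dcoset1_longestr _ fL) (bimax_longestr KL fL)).
set y := m * (longest S K)^-1 => szy; split; last exact: szy.
have mL : coset_max L (y * longest S L).
  move=> s Ls; rewrite /inversion szy -mulgA.
  by apply: leq_ltn_trans (ellM _ _) _; rewrite ltn_add2l;
    apply: longest_coset_max Ls.
have yE : y * longest S L = m * ((longest S K)^-1 * longest S L) by rewrite
  mulgA.
have gKL : generated L ((longest S K)^-1 * longest S L).
  apply: generatedM; last exact: longest_generated.
  by rewrite generatedVE; apply: generatedS KL _ _; apply: longest_generated.
have -> : cox_star S m (longest S L) = y * longest S L.
  by rewrite yE in mL *; apply: cox_star_longest.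
split=> //; split=> // s Is.
have rs : reflection S s by apply: reflection_simple; case: fI => IS _;
  apply: IS.
have := mI s Is; rewrite -{1}[m](mulgVK (longest S K)) -/y !(invgM y)
  !(inversionM _ y^-1) // !invgK.
(* The left descent [s] of [m] comes either from [y], and then additivity of lengths keeps [w_L]
   from cancelling it, or from [w_K], and then its conjugate lies in [W_L], all of whose reflections
   [w_L^-1] inverts. *)
have [Ny _|_] := boolP (inversion y^-1 s).
  rewrite addbT; have := inversion_disjoint (w := (longest S L)^-1) _ rs Ny.
  by rewrite invgK; apply; rewrite -invgM !ellV szy addnC.
rewrite !addbF => /inversion_generated h.
apply: longestV_inversion => //; first exact: reflectionJ.
apply: generatedS KL _ _; apply: h => //; last exact: reflectionJ.
by rewrite generatedVE; apply: longest_generated.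
Qed.

Lemma coset_star_down (I K L p : set W) m :
  finitary S I -> finitary S K -> finitary S L -> L `<=` K ->
  coset_with_max I K p m ->
  coset_with_max I L (coset_star S I L p (dcoset K 1 L)) m.
Proof.
move=> fI fK fL LK [-> mIK]; have [mK mI] := mIK.
rewrite /coset_star (max_eltE fI fK (dcoset_refl _ _ _) mIK).
rewrite (max_eltE fK fL (dcoset1_longest _ fK) (bimax_longest LK fK)).
have [KS Kfin] := fK; have -> : cox_star S m (longest S K) = m.
  by rewrite -[RHS]mulg1; apply: cox_star_longest; rewrite ?mulg1 //;
    exact: generated1.
by split=> //; split=> // s /LK; apply: mK.
Qed.

Lemma coset_with_max1 (I P : set W) : I `<=` P -> finitary S P ->
  coset_with_max I P (dcoset I 1 P) (longest S P).
Proof.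
move=> IP fP; split; last exact: bimax_longestr.
exact/dcoset_eq/dcoset1_longestr.
Qed.

Lemma coset_with_max_id (I : set W) : finitary S I ->
  coset_with_max I I (dcoset I 1 I) (longest S I).
Proof. exact: coset_with_max1. Qed.

(** Let [x] be the minimal element of the coset. The core condition [L = x L' x^-1] lets a left
    factor in [W_L] pass across [x], so [w_P w_L'^-1] lies in [x W_L']. Both elements are minimal
    there, hence equal. *)
Lemma atom_conj (L P L' : set W) : L `<=` P -> L' `<=` P ->
  finitary S L -> finitary S P -> finitary S L' ->
  is_core S L L' (expressed S [:: L; P; L']) ->
  forall x, generated L x <->
    generated L' (x ^ (longest S P * (longest S L')^-1)).
Proof.
move=> LP L'P fL fP fL' [_ LE].
have [pE _] := coset_star_down fL fP fL' L'P (coset_with_max1 LP fP).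
have [PS Pfin] := fP; have [L'S L'fin] := fL'.
have [hx xmin] := min_elt_spec L (longest S P) L'S.
rewrite /= pE in LE; set x := min_elt _ _ in hx xmin LE.
have aL' : coset_max L' (longest S P).
  by move=> s /L'P; apply: longest_coset_max.
have [amin _] := coset_max_longest L'S L'fin aL'.
set a := _ * _ in amin *.
have Lx j : L j <-> L' (j ^ x).
  rewrite {1}LE; split=> [[u hu <-]|hj]; first by rewrite conjgE mulgVK mulKg.
  by exists (j ^ x); rewrite // conjgE mulVKg mulgK.
have Lgx := generated_conj Lx.
suff -> : a = x by exact: Lgx.
have /dcosetP[l [l' [gl gl' wE]]] := dcoset_sym hx.
have aE : a = x * (l ^ x * l' * (longest S L')^-1).
  by rewrite /a {1}wE conjgE !mulgA mulgV mul1g.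
rewrite aE in amin *; rewrite (coset_min_unique L'S xmin amin) ?mulg1 //.
apply: generatedM; last by rewrite generatedVE; exact: longest_generated.
by apply: generatedM => //; apply/Lgx.
Qed.

(** In [a^-1 = w_L' w_P^-1] the factor [w_P^-1] inverts exactly the reflections of [W_P], and [w_L']
    cancels those that conjugation by [w_P] sends into [W_L'], which are those of [W_L]. *)
Lemma atom_inversion (L P L' : set W) t :
  L `<=` P -> finitary S P -> finitary S L' ->
  let a := longest S P * (longest S L')^-1 in
  (forall x, generated L x <-> generated L' (x ^ a)) ->
  reflection S t -> inversion a^-1 t <-> generated P t /\ ~ generated L t.
Proof.
move=> LP [PS Pfin] [L'S L'fin] a La rt.
have gP := longest_generated Pfin; have gL' := longest_generated L'fin.
have rt' : reflection S (t ^ longest S P) by apply: reflectionJ.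
have -> : inversion a^-1 t =
    inversion (longest S L') (t ^ longest S P) (+) inversion (longest S P)^-1 t.
  by rewrite /a invgM invgK inversionM // invgK.
have E1 : inversion (longest S L') (t ^ longest S P) <-> generated L t.
  rewrite La -(generatedJ _ gL') -conjgM mulgVK.
  by split; [apply: inversion_generated | apply: longest_inversion].
have E2 : inversion (longest S P)^-1 t <-> generated P t.
  split; last exact: longestV_inversion.
  by apply: inversion_generated; rewrite ?generatedVE.
have LPt : generated L t -> generated P t by apply: generatedS.
split=> [|[/E2-> /E1/negP/negPf->]] //.
case: (boolP (inversion _ (t ^ _))) E1 => /= [_ [/(_ isT)/LPt/E2-> _]|_ [_ h]]
  //.
by move=> /E2 gPt; split=> // /h.
Qed.

(** * Intersections of parabolic subgroups *)

(** Since [r * x = x * r ^ x], minimality of [x^-1] gives [ell r + ell x] as the length of the left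
    side, while the right side has length at most [ell x + 1]. *)
Lemma simple_conj (I : set W) (x r : W) : I `<=` S -> coset_min I x^-1 ->
  generated I r -> S (r ^ x) -> I r.
Proof.
move=> IS xmin gr Srx; apply: simple_generated => //; apply: ell1_simple.
have r1 : ell r <> 0%N.
  by move/ell_eq0 => r1; have := coxeter_neq1 hS Srx; rewrite r1 conj1g eqxx.
have E : r * x = x * r ^ x by rewrite conjgE mulVKg.
have := ellM x (r ^ x); rewrite -E -(ellV (r * x)) invgM (coset_minM IS xmin);
  last first.
  by rewrite generatedVE.
by rewrite !ellV (ell_simple Srx) leq_add2l; case: (ell r) r1 => [|[]].
Qed.

(* Kilmoyer's theorem on intersections of parabolic subgroups. *)
Lemma kilmoyer (P Q : set W) x h : P `<=` S -> Q `<=` S ->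
  coset_min P x^-1 -> coset_min Q x ->
  generated P h -> generated Q (h ^ x) ->
  generated [set k | P k /\ Q (k ^ x)] h.
Proof.
move=> PS QS xP xQ; have [n] := ubnP (ell h).
elim: n h => // n IH h; rewrite ltnS => szn gh gv.
have [->|h1] := eqVneq h 1; first exact: generated1.
have [|s Qs Ns] := descent_exists QS gv; first by apply/eqP; rewrite conjg_eq1.
have [rs gs] := (reflection_simple (QS _ Qs), sub_generated Qs).
(* Comparing [h * x = x * h ^ x] shows that the descent [s] of [h ^ x] comes from an inversion [r]
   of [h]. By [simple_conj] it is a simple generator in [P], and it can be split off [h]. *)
pose r := s ^ x^-1; have rx : r ^ x = s by rewrite conjgKV.
have Nr : inversion h r.
  have := coset_min_inversion xQ gv rs gs.
  have -> : x * h ^ x = h * x by rewrite conjgE mulVKg.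
  by rewrite Ns inversionM // (negPf (xQ _ rs gs)) addbF.
have Pr : P r.
  apply: (simple_conj (x := x)) => //; last by rewrite rx; apply: QS.
  by apply: inversion_generated Nr => //; apply: reflectionJ.
have Kr : generated [set k | P k /\ Q (k ^ x)] r.
  by apply: sub_generated; rewrite /= rx.
rewrite -(generated_mulr h Kr); apply: IH.
- exact: leq_trans Nr szn.
- by apply: generatedM => //; apply: sub_generated.
- by rewrite conjMg rx; apply: generatedM.
Qed.

(* By Kilmoyer, [W_P] meets [y W_Q y^-1] in a conjugate [u W_K u^-1] with [u] in
   [W_P] and [K `<=` P].  It contains [W_L], so [K] contains a conjugate of [L];
   if [K] were not [P] it would equal that conjugate for lack of elements, and
   the intersection would be [W_L], which does not contain [t]. *)
Lemma parabolic_corank1 (L P Q : set W) s0 t y :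
  finitary S P -> Q `<=` S -> ~ L s0 -> P = s0 |` L ->
  (forall x, generated L x -> generated Q (x ^ y)) ->
  generated P t -> ~ generated L t -> generated Q (t ^ y) ->
  forall h, generated P h -> generated Q (h ^ y).
Proof.
move=> [PS Pfin] QS Ls0 PE LQ gt Lt Qt h gh.
have [x hx xmin] := set_argmin ell (dcoset_refl P Q y).
have /dcosetP[u [v [gu gv yE]]] := dcoset_sym hx.
have xQ : coset_min Q x.
  move=> r _ gr; rewrite /inversion -leqNgt; apply: xmin.
  by rewrite -[x]mul1g; apply: dcosetM => //; apply: generated1.
have xP : coset_min P x^-1.
  move=> r rr gr; rewrite /inversion -leqNgt -(ellV (_ * r)) ellV invgM invgK.
  rewrite reflectionV //; apply: xmin.
  by rewrite -[_ * _]mulg1; apply: dcosetM => //; apply: generated1.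
pose K := [set k | P k /\ Q (k ^ x)].
have KP : K `<=` P by move=> k [].
have KS := subset_trans KP PS.
have QE z : generated P z -> generated Q (z ^ y) <-> generated K (z ^ u).
  move=> gz; rewrite yE !conjgM generatedJ //; split=> [hz|].
    by apply: kilmoyer hz => //; rewrite generatedJ.
  by apply: generated_conj_sub => k [_ Qk]; apply: sub_generated.
rewrite QE //; have [PK|] := pselect (P `<=` K).
  by apply: (generatedS PK); rewrite generatedJ.
move=> /existsNP[k0 /not_implyP[Pk0 Kk0]]; exfalso; apply: Lt.
(* Making [u * b] minimal in [u W_K] lets [simple_conj] place the conjugates of [L] in [K] itself,
   not merely in [W_K]. *)
have [b gb umin] := coset_min_exists K u.
have KE z : generated K (z ^ (u * b)) <-> generated K (z ^ u).
  by rewrite conjgM generatedJ.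
have LP : L `<=` P by rewrite PE => s; right.
have LK s : L s -> K (s ^ (u * b)).
  move=> Ls; have gs := sub_generated (LP _ Ls).
  have sK : generated K (s ^ (u * b)) by rewrite KE -QE //; apply: LQ;
    exact: sub_generated.
  by apply: (simple_conj (x := (u * b)^-1)); rewrite ?invgK ?conjgK //;
    apply/PS/LP.
have Lfin : finite_set L.
  by apply: sub_finite_set Pfin => s /LP; apply: sub_generated.
have [r0 rE] := (finite_seqP L).1 Lfin; pose r := undup r0.
have {}rE s : L s <-> s \in r by rewrite rE mem_undup.
(* [k0] and the conjugates of [L] are [size r + 1] distinct elements of [P], so they exhaust it. As
   [K] misses [k0], it is exactly the conjugate of [L]. *)
pose ks := k0 :: [seq s ^ (u * b) | s <- r].
have ks_uniq : uniq ks.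
  rewrite /= map_inj_uniq ?undup_uniq ?andbT; last exact: conjg_inj.
  by apply/mapP => -[s /rE /LK sK k0E]; apply: Kk0; rewrite k0E.
have ksP : {subset ks <= s0 :: r}.
  suff sP k : P k -> k \in s0 :: r.
    by move=> k; rewrite in_cons => /predU1P[->|/mapP[s /rE/LK/KP Ps ->]];
      apply: sP.
  by rewrite PE in_cons => -[->|/rE->]; rewrite ?eqxx ?orbT.
have [|_ ksE] := uniq_min_size ks_uniq ksP; first by rewrite /= size_map.
have LKE s : L s <-> K (s ^ (u * b)).
  split=> [|sK]; first exact: LK.
  have : s ^ (u * b) \in ks.
    rewrite ksE in_cons; have := KP _ sK; rewrite PE => -[->|/rE->].
      by rewrite eqxx.
    by rewrite orbT.
  rewrite in_cons => /predU1P[E|]; first by case: Kk0; rewrite -E.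
  by case/mapP=> s' /rE Ls' /conjg_inj->.
by rewrite (generated_conj LKE) KE -QE.
Qed.

(** * Atomic expressions *)

Section Chain.
Variable I : set W.

Definition atom_elt (P L : set W) := longest S P * (longest S L)^-1.

(* [y] is a reduced product of atoms [a_1 ... a_m]; the blocks are the
   parabolic subgroups [y W_P y^-1] for its prefixes [y], last one first. *)
Inductive atomic_chain : set W -> W -> seq (set W) -> Prop :=
| chain_nil : atomic_chain I 1 [::]
| chain_cons L y Qs s P L' of
    atomic_chain L y Qs & finitary S P & finitary S L' &
    ~ L s & P = s |` L &
    (forall x, generated L x <-> generated L' (x ^ atom_elt P L')) &
    ell (y * atom_elt P L') = (ell y + ell (atom_elt P L'))%N :
  atomic_chain L' (y * atom_elt P L') ([set x | generated P (x ^ y)] :: Qs).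

Lemma atomic_chain_conj L y Qs : atomic_chain L y Qs ->
  forall x, generated I x <-> generated L (x ^ y).
Proof.
elim=> [x|{}L {}y {}Qs s P L' _ IH _ _ _ _ La _ x]; first by rewrite conjg1.
by rewrite IH La conjgM.
Qed.

Lemma atomic_chain_block L y Qs Q : atomic_chain L y Qs -> Q \in Qs ->
  exists L0 s P z, [/\ finitary S P, ~ L0 s, P = s |` L0,
    forall x, generated I x <-> generated L0 (x ^ z) &
    Q = [set x | generated P (x ^ z)]].
Proof.
elim=> // {}L {}y {}Qs s P L' hc IH fP _ Ls PE _ _.
rewrite in_cons => /predU1P[->|]; last exact: IH.
by exists L, s, P, y; split=> //; apply: atomic_chain_conj hc.
Qed.

(** A new atom [a] adds its left inversions, transported by [y]. Additivity of lengths makes them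
    disjoint from those of [y], so the exclusive or of the cocycle is a union. *)
Lemma atomic_chain_inversion L y Qs t : atomic_chain L y Qs -> reflection S t ->
  inversion y^-1 t <-> exists2 Q, Q \in Qs & Q t /\ ~ generated I t.
Proof.
move=> + rt; elim=> [|{}L {}y {}Qs s P L' hc IH fP fL' _ PE La szy].
  by rewrite invg1 inversion1; split=> // -[].
have LP : L `<=` P by rewrite PE => u; right.
have Na := atom_inversion LP fP fL' La (reflectionJ y rt).
rewrite -/(atom_elt P L') -(atomic_chain_conj hc) in Na.
have disj : inversion y^-1 t -> ~~ inversion (atom_elt P L')^-1 (t ^ y).
  move=> /(inversion_disjoint (w := (atom_elt P L')^-1) _ rt); rewrite invgK.
  by apply; rewrite -invgM !ellV addnC.
rewrite invgM inversionM // invgK; split.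
  case: (boolP (inversion y^-1 t)) disj => [/IH [Q hQ Qt] _|Ny _].
    by exists Q; rewrite // in_cons hQ orbT.
  by rewrite addbF => /Na ?; eexists; first exact: mem_head.
case=> Q; rewrite in_cons => /predU1P[->/Na Nat|hQ Qt].
  by rewrite Nat; case: inversion disj => // /(_ isT); rewrite Nat.
have Ny : inversion y^-1 t by apply/IH; exists Q.
by rewrite Ny (negPf (disj Ny)).
Qed.

(** The generator added by the atom, transported back by the prefix, is a witness; thus every block
    is visible in the inversion set. *)
Lemma block_reflection L y Qs Q : atomic_chain L y Qs -> Q \in Qs ->
  exists t, [/\ reflection S t, Q t & ~ generated I t].
Proof.
move=> hc /(atomic_chain_block hc) [L0 [s [P [z [[PS _] Ls PE Iz ->]]]]].
have Ps : P s by rewrite PE; left.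
have LS : L0 `<=` S by move=> u Lu; apply: PS; rewrite PE; right.
exists (s ^ z^-1); split; rewrite /= ?Iz ?conjgKV.
- exact/reflectionJ/reflection_simple/PS.
- exact: sub_generated.
- by move/(simple_generated LS (PS _ Ps)).
Qed.

(** If the new block had occurred before, its reflection outside [W_I] would be inverted by both the
    prefix and the new atom, against additivity of lengths. *)
Lemma atomic_chain_uniq L y Qs : atomic_chain L y Qs -> uniq Qs.
Proof.
move=> hc; elim: (hc) => // {hc}L {}y {}Qs s P L' hc IH fP fL' Ls PE La szy.
rewrite /= IH andbT; apply/negP => hQ.
have LP : L `<=` P by rewrite PE => u; right.
have [t [rt Qt It]] := block_reflection hc hQ.
have Ny : inversion y^-1 t by apply/(atomic_chain_inversion hc) => //;
  eexists; first exact: hQ.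
have /negP : ~~ inversion (atom_elt P L')^-1 (t ^ y).
  have := inversion_disjoint (w := (atom_elt P L')^-1) _ rt Ny; rewrite invgK.
  by apply; rewrite -invgM !ellV szy addnC.
apply; apply/(atom_inversion LP fP fL' La (reflectionJ y rt)).
by rewrite -(atomic_chain_conj hc).
Qed.

(** Conjugation by [z] makes the first block standard, and [W_I] becomes its corank-one subgroup
    [W_K]; the second block is then seen through [z^-1 * z']. *)
Lemma block_sub L y Qs Q L' y' Qs' Q' t :
  atomic_chain L y Qs -> Q \in Qs -> atomic_chain L' y' Qs' -> Q' \in Qs' ->
  Q t -> Q' t -> ~ generated I t -> Q `<=` Q'.
Proof.
move=> hc /(atomic_chain_block hc) [K [s [P [z [fP Ks PE Iz ->]]]]].
move=> hc' /(atomic_chain_block hc') [K' [s' [P' [z' [fP' Ks' PE' Iz' ->]]]]].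
move=> /= Pt Pt' It x Px /=.
have E u : (u ^ z) ^ (z^-1 * z') = u ^ z' by rewrite conjgM conjgK.
rewrite -E; apply: (parabolic_corank1 (t := t ^ z) fP _ Ks PE) => //.
- by case: fP'.
- move=> u; rewrite -{1}[u](conjgKV z) -Iz Iz' -E conjgKV.
  by apply: generatedS; rewrite PE' => v; right.
- by rewrite -Iz.
- by rewrite E.
Qed.

Lemma atomic_chain_size L y Qs L' Qs' :
  atomic_chain L y Qs -> atomic_chain L' y Qs' -> (size Qs <= size Qs')%N.
Proof.
move=> hc hc'; apply: uniq_leq_size; first exact: atomic_chain_uniq hc.
move=> Q hQ; have [t [rt Qt It]] := block_reflection hc hQ.
have : inversion y^-1 t by apply/(atomic_chain_inversion hc rt); exists Q.
case/(atomic_chain_inversion hc' rt) => Q' hQ' [Qt' _].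
suff -> : Q = Q' by [].
apply/seteqP; split; first exact: (block_sub hc hQ hc' hQ' Qt Qt' It).
exact: (block_sub hc' hQ' hc hQ Qt' Qt It).
Qed.

End Chain.

Lemma compose_steps_rcons (I p K L : set W) (r : seq (set W)) :
  compose_steps S I p K (rcons r L) =
  coset_star S I L (compose_steps S I p K r) (dcoset (last K r) 1 L).
Proof. by elim: r p K => //= M r IH p K; rewrite IH. Qed.

(** The case [i = 0] is left out because [expressed] starts from the coset of the first step instead
    of multiplying it onto an identity coset. *)
Lemma expressed_take (e : seq (set W)) i : (0 < i)%N -> (i.+1 < size e)%N ->
  expressed S (take i.+2 e) =
  coset_star S (nth set0 e 0) (nth set0 e i.+1) (expressed S (take i.+1 e))
    (dcoset (nth set0 e i) 1 (nth set0 e i.+1)).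
Proof.
case: i => // i _ hi; rewrite (take_nth set0 hi).
case: e hi => [|A [|B r]] //= hi.
rewrite compose_steps_rcons; congr (coset_star _ _ _ _ (dcoset _ _ _)).
rewrite (last_nth set0) size_takel; last by rewrite ltnW // -ltnS.
by case: i hi => //= i hi; rewrite nth_take.
Qed.

Lemma coset_with_max_elt (I K p : set W) m : finitary S I -> finitary S K ->
  coset_with_max I K p m -> max_elt S p = m.
Proof. by move=> fI fK [-> mIK]; apply: max_eltE => //; apply: dcoset_refl. Qed.

Lemma atomic_expression_chain (e : seq (set W)) k :
  is_atomic S e -> expr_reduced S e -> (k.*2 <= width e)%N ->
  let I := nth set0 e 0 in let L := nth set0 e k.*2 in
  exists y Qs, [/\ atomic_chain I L y Qs, size Qs = k &
    coset_with_max I L (expressed S (take k.*2.+1 e)) (y * longest S L)].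
Proof.
move=> [[sz0 fin _] _ atoms] hre; elim: k => [|k IH] hk.
  exists 1, [::]; split=> //; first exact: chain_nil.
  rewrite mul1g; have := fin 0%N isT; case: e sz0 {fin atoms hre hk} =>
    //= A r _ fA.
  by rewrite take0; apply: coset_with_max_id.
rewrite doubleS in hk; have hk0 : (k.*2 <= width e)%N by apply: ltnW;
  apply: ltnW.
have [y [Qs [hc szQ hm]]] := IH hk0.
have {atoms} [] := atoms k hk; rewrite doubleS.
have sze : size e = (width e).+1 by rewrite /width prednK.
have := fin _ (leq0n _); have := fin _ hk0; have := fin _ (ltnW hk);
  have := fin _ hk.
have up : nth set0 e k.*2 `<=` nth set0 e k.*2.+1 ->
    let P := nth set0 e k.*2.+1 in
    coset_with_max (nth set0 e 0) P (expressed S (take k.*2.+2 e)) (y * longest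
      S P) /\
    ell (y * longest S P) = (ell y + ell (longest S P))%N.
  move=> LP P; have [fI fL fP] := And3 (fin _ (leq0n _)) (fin _ hk0) (fin _
    (ltnW hk)).
  (* [expr_reduced] imposes nothing at index 0. There the chain is empty, [y = 1], and additivity is
     trivial. *)
  case: (posnP k) => [k0|k0].
    have -> : y = 1 by rewrite k0 in szQ; case: hc szQ.
    rewrite !mul1g ell1; split=> //; subst k.
    case: e {hm hc IH fin hre hk0} sz0 sze hk LP @P fI fL fP =>
      [|A [|B r]] //= _ _ _ AB fA _ fB.
    by rewrite k0 /= in AB fB *; rewrite take0; apply: coset_with_max1.
  have E : (0 < k.*2)%N by rewrite double_gt0.
  rewrite expressed_take //; last by rewrite sze ltnS ltnW.
  have hr := hre k.*2; rewrite E (ltnW hk) in hr.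
  by have := coset_star_up fI fL fP LP hm (hr isT); rewrite mulgK.
set L := nth set0 e k.*2 in hc hm up *; set P := nth set0 e k.*2.+1 in up *.
set L' := nth set0 e k.*2.+2; set I := nth set0 e 0 in hc hm up *.
move=> fL' fP fL fI [s [t [Ls PE Pt L'E]]] [hcore _].
have LP : L `<=` P by rewrite PE => u; right.
have L'P : L' `<=` P by rewrite L'E => u [].
have [hP szP] := up LP.
have aE : y * atom_elt P L' * longest S L' = y * longest S P.
  by rewrite /atom_elt mulgA mulgVK.
have [[PS Pfin] [L'S L'fin]] := (fP, fL').
have aL' : coset_max L' (longest S P).
  by move=> u /L'P; apply: longest_coset_max.
have [_ sza] := coset_max_longest L'S L'fin aL'.
exists (y * atom_elt P L'), ([set x | generated P (x ^ y)] :: Qs); split.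
- apply: (chain_cons (s := s)) hc _ _ _ _ _ _ => //.
    exact: atom_conj hcore.
  (* Lengths add in both [y * w_P] and [w_P = a * w_L']; cancelling the length of [w_L'] gives
     additivity for [y * a]. *)
  apply/eqP; rewrite eqn_leq ellM -(leq_add2r (ell (longest S L'))).
  by rewrite -addnA -sza -szP -aE ellM.
- by rewrite /= szQ.
- rewrite aE expressed_take ?sze //.
  exact: coset_star_down hP.
Qed.

(** Either expression yields [max_elt S p = y * w_J], so both chains factor the same [y], and their
    blocks can be compared. *)
Lemma atomic_width_leq (I J p : set W) (e e' : seq (set W)) :
  finitary S I -> finitary S J ->
  is_atomic S e -> expr_reduced S e -> expresses S e I J p ->
  is_atomic S e' -> expr_reduced S e' -> expresses S e' I J p ->
  (width e <= width e')%N.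
Proof.
move=> fI fJ.
have chain (f : seq (set W)) : is_atomic S f -> expr_reduced S f ->
  expresses S f I J p ->
    exists y Qs, [/\ atomic_chain I J y Qs, (size Qs).*2 = width f &
      max_elt S p = y * longest S J].
  move=> hf hrf [[sz0 _ _] fI0 fJ0 fp]; have [_ wf _] := hf.
  have wE : (width f)./2.*2 = width f by rewrite -[RHS]odd_double_half (negPf
    wf).
  have := @atomic_expression_chain f (width f)./2 hf hrf; rewrite wE fI0 fJ0.
  case=> // y [Qs [hc szQ hm]]; exists y, Qs; split=> //; first by rewrite szQ.
  by apply: (coset_with_max_elt fI fJ); rewrite -fp -[f in expressed S
    f]take_size -(prednK sz0).
move=> /chain h /h{}h /h{h} [y [Qs [hc <- E]]] /chain h /h{}h /h{h} [y' [Qs'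
  [hc' <- E']]].
have yy' : y = y' by apply: (@mulIg _ (longest S J)); rewrite -E -E'.
by rewrite leq_double; rewrite yy' in hc; apply: atomic_chain_size hc hc'.
Qed.

End Length.

Theorem corollary5p5 (W : groupType) (S : set W) (hS : coxeter_system S)
    (I J p : set W) (hI : finitary S I) (hJ : finitary S J)
    (hp : is_core S I J p) (e e' : seq (set W))
    (he : is_atomic S e) (hre : expr_reduced S e) (hpe : expresses S e I J p)
    (he' : is_atomic S e') (hre' : expr_reduced S e')
    (hpe' : expresses S e' I J p) :
  width e = width e'.
Proof.
apply/eqP; rewrite eqn_leq (atomic_width_leq hS hI hJ he hre hpe he' hre' hpe').
exact: (atomic_width_leq hS hI hJ he' hre' hpe' he hre hpe).
Qed.
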